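(* For any real number $\varepsilon>0$, and for integers $n>1/\alpha$, $$\mathbb{P}(Y\ge n) = O\left(n\left(\sqrt{1-p^2}\right)^n\right) = O\left(\left(\sqrt{1-p^2}+\varepsilon\right)^n\right),$$ where the implied constant in the first bound depends only on $p$ and in the second only on $p$ and $\varepsilon$ (neither depends on $n$ or $N$).
   Context: Fix a real number $0<p<1$ and an integer $N\ge 0$. Let $A$ be a random subset of $\{0,\dots,N\}$ in which each integer in $\{0,\dots,N\}$ is included independently with probability $p$, and let $A+A=\{a+b : a,b\in A\}$ ($a=b$ allowed). Let $Y=|\{0\le n\le N : n\notin A+A\}|$. Set $\alpha = \log\frac{1}{\sqrt{1-p^2}}>0$. *)

(* Defs.v *)
From HB Require Import structures.
From mathcomp Require Import all_boot all_order all_algebra.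
From mathcomp Require Import all_classical all_reals all_analysis.

Set Implicit Arguments.
Unset Strict Implicit.
Unset Printing Implicit Defensive.

Import Order.TTheory GRing.Theory Num.Theory.

Local Open Scope classical_set_scope.
Local Open Scope ring_scope.

(* 'I_N.+1 plays the role of {0, ..., N}; the sums a + b live in nat and may
   exceed N. *)
Definition sumset (N : nat) (A : {set 'I_N.+1}) : pred nat :=
  [pred m : nat | [exists a in A, exists b in A, m == (a + b)%N]].

Definition missing_sums (N : nat) (A : {set 'I_N.+1}) : nat :=
  #|[pred n : 'I_N.+1 | (n : nat) \notin sumset A]|.

Definition mutually_independent (d : measure_display) (T : measurableType d)
    (R : realType) (P : probability T R) (I : finType) (E : I -> set T) : Prop :=
  forall J : {set I},
    P (\bigcap_(i in [set` J]) E i) = (\prod_(i in J) P (E i))%E.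

(* The inclusion events generate the (finite) sigma-algebra of A, so their
   measurability is exactly that of A as a set-valued random variable. *)
Definition bernoulli_random_set (d : measure_display) (T : measurableType d)
    (R : realType) (P : probability T R) (p : R) (N : nat)
    (A : T -> {set 'I_N.+1}) : Prop :=
  [/\ forall k : 'I_N.+1, measurable [set w | k \in A w],
      forall k : 'I_N.+1, P [set w | k \in A w] = p%:E &
      mutually_independent P (fun k : 'I_N.+1 => [set w | k \in A w])].

Definition decay_rate (R : realType) (p : R) : R :=
  ln (1 / Num.sqrt (1 - p ^+ 2)).

(* Main.v *)
Require Import Defs.
From HB Require Import structures.
From mathcomp Require Import all_boot all_order all_algebra.
From mathcomp Require Import all_classical all_reals all_analysis.
From mathcomp Require Import zify ring lra.
Import Order.TTheory GRing.Theory Num.Theory.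
Local Open Scope classical_set_scope.
Local Open Scope ring_scope.

(** A set that misses [n >= 1] of the integers [0, ..., N] misses one of them
    that is at least [n - 1].  So only large missing integers matter, and a
    union bound over the single integers [k >= n - 1] is enough.

    Write [b] for the square root of [1 - p ^ 2].  The involution
    [i |-> k - i] cuts [0, ..., k] into blocks [{i, k - i}] of one or two
    elements, and [k] is a sum of two elements of [A] exactly when [A] contains
    one of the blocks.  The blocks are disjoint, so they are avoided
    independently ([prob_avoid]), the block [B] with probability
    [1 - p ^ #|B|].  This number is [b ^ 2] for a block of two elements and
    [1 - p <= b] for a block of one, hence at most [b ^ #|B|] in both cases.
    The sizes of the blocks add up to [k + 1], so [k] is missing with
    probability at most [b ^ (k + 1)] ([prob_missing_le]).

    Summing the geometric series over [k >= n - 1] gives the bound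
    [b ^ n / (1 - b)] ([prob_many_missing_le]), which is stronger than the first
    estimate because [n >= 1] as soon as [n] exceeds the positive number
    [1 / decay_rate p].  The second estimate follows from Bernoulli's inequality
    for [(1 + eps / b) ^ n]. *)

Section Base.
Context (R : realType) (p : R).
Hypotheses (hp0 : 0 < p) (hp1 : p < 1).

Local Notation b := (Num.sqrt (1 - p ^+ 2)).

Lemma base_sqr : b ^+ 2 = 1 - p ^+ 2.
Proof. by rewrite sqr_sqrtr // subr_ge0 exprn_ile1 // ltW. Qed.

Lemma base_gt0 : 0 < b.
Proof. by rewrite sqrtr_gt0 subr_gt0 exprn_ilt1 // ltW. Qed.

Lemma base_lt1 : b < 1.
Proof. by rewrite -[ltRHS]sqrtr1 ltr_sqrt // gtrBl exprn_gt0. Qed.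

(** A block of two elements gives equality; for one element the reason is
    [(1 - p) ^ 2 <= (1 - p) * (1 + p)]. *)
Lemma block_factor_le (m : nat) : (m <= 2)%N -> 1 - p ^+ m <= b ^+ m.
Proof.
case: m => [|[|[|//]]] _; rewrite ?base_sqr ?expr0 ?subrr ?expr1 //.
rewrite -ler_sqr ?nnegrE ?subr_ge0 ?ltW ?base_gt0 // base_sqr.
have : 0 < p * (1 - p) by rewrite mulr_gt0 ?subr_gt0.
lra.
Qed.

Lemma decay_rate_gt0 : 0 < decay_rate p.
Proof.
by rewrite ln_gt0 // div1r invf_gt1 ?base_lt1 // base_gt0.
Qed.

End Base.

(** Dividing by [x ^ n] turns this into Bernoulli's inequality
    [n * (e / x) <= (1 + e / x) ^ n]. *)
Lemma natr_mul_expr_le (R : realFieldType) (x e : R) (n : nat) :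
  0 < x -> 0 < e -> n%:R * x ^+ n <= x / e * (x + e) ^+ n.
Proof.
move=> x0 e0.
have bernoulli : n%:R * (e / x) <= (1 + e / x) ^+ n.
  have : 0 < e / x by rewrite divr_gt0.
  move: (e / x) => t t0.
  suff : 1 + n%:R * t <= (1 + t) ^+ n by apply: le_trans; rewrite lerDr.
  elim: n => [|n IHn]; first by rewrite mul0r addr0 expr0.
  rewrite exprS; apply: (@le_trans _ _ ((1 + t) * (1 + n%:R * t))).
    have : 0 <= n%:R * t * t by rewrite !mulr_ge0 // ltW.
    by rewrite -natr1; lra.
  by apply: ler_wpM2l => //; rewrite addr_ge0 // ltW.
have -> : x + e = x * (1 + e / x) by field; rewrite gt_eqF.
rewrite exprMn.
have -> : n%:R * x ^+ n = x / e * (x ^+ n * (n%:R * (e / x))).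
  by field; rewrite !gt_eqF.
by rewrite ler_pM2l ?divr_gt0 // ler_pM2l // exprn_gt0.
Qed.

(** [n] distinct integers in [0, ..., N] cannot all be smaller than [n - 1].
    The witness is written [n - 1 + i] so that a sum over [i] is a geometric
    series. *)
Lemma missing_sums_large (N : nat) (S : {set 'I_N.+1}) (n : nat) :
  (0 < n)%N -> (n <= missing_sums S)%N ->
  exists2 i, (i < N.+1 - n.-1)%N & (n.-1 + i)%N \notin sumset S.
Proof.
move=> n0 nS.
have [/existsP[k /andP[kS kn]]|] :=
    boolP [exists k : 'I_N.+1, ((k : nat) \notin sumset S) && (n.-1 <= k)%N].
  by exists (k - n.-1)%N; [have := ltn_ord k; lia | rewrite subnKC].
rewrite negb_exists => /forallP none.
pose Q := [pred k : 'I_N.+1 | (k : nat) \notin sumset S].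
have : (size [seq val k | k <- enum Q] <= size (iota 0 n.-1))%N.
  apply: uniq_leq_size; first by rewrite (map_inj_uniq val_inj) enum_uniq.
  move=> _ /mapP[k + ->]; rewrite mem_enum inE => kS.
  by have := none k; rewrite kS /= -ltnNge mem_iota.
by rewrite size_map size_iota -cardE => /(leq_trans nS); lia.
Qed.

Definition avoids (I : finType) (s : seq {set I}) (S : {set I}) : bool :=
  all (fun B : {set I} => ~~ (B \subset S)) s.
Arguments avoids {I} s S.

Section RandomSet.
Context (R : realType) (p : R) (N : nat) (d : measure_display)
  (T : measurableType d) (P : probability T R) (A : T -> {set 'I_N.+1}).
Hypothesis A_bernoulli : bernoulli_random_set P p A.

(** The set-valued random variable takes finitely many values, and each of them
    is determined by finitely many inclusion events. *)
Lemma measurable_random_set (Q : pred {set 'I_N.+1}) :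
  measurable [set w | Q (A w)].
Proof.
have [mA _ _] := A_bernoulli.
have -> : [set w | Q (A w)] =
    \bigcup_(S in [set` Q]) \bigcap_(i in [set: 'I_N.+1])
      (if i \in S then [set w | i \in A w] else ~` [set w | i \in A w]).
  apply/seteqP; split=> [w QA | w [S QS SA]] /=.
    by exists (A w) => // i _; case: ifPn => // /negP.
  suff -> : A w = S by [].
  apply/setP => i; have := SA i I; case: ifPn => iS //= /negP niA.
  exact: negbTE.
apply: fin_bigcup_measurable => // S _.
apply: fin_bigcap_measurable => // i _.
by case: ifP => _; [|apply: measurableC].
Qed.

Lemma prob_superset (K : {set 'I_N.+1}) :
  P [set w | K \subset A w] = (p ^+ #|K|)%:E.
Proof.
have [_ PA indep] := A_bernoulli.
have -> : [set w | K \subset A w] = \bigcap_(i in [set` K]) [set w | i \in A w].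
  apply/seteqP; split=> w /= => [/fintype.subsetP KA i /KA // | KA].
  by apply/fintype.subsetP => i /KA.
rewrite indep; under eq_bigr do rewrite PA.
by rewrite -(big_morph EFin (@EFinM R) erefl) prodr_const.
Qed.

(** Adding a block [B] to the avoided ones is a difference of two events: the
    one without [B], minus the one in which [B] joins the contained set [K].
    Carrying [K] along is what makes the induction go through. *)
Lemma prob_contain_avoid (K : {set 'I_N.+1}) (s : seq {set 'I_N.+1}) :
  pairwise (fun B C : {set 'I_N.+1} => [disjoint B & C]%B) (K :: s) ->
  P [set w | (K \subset A w) && avoids s (A w)]
    = (p ^+ #|K| * \prod_(B <- s) (1 - p ^+ #|B|))%:E.
Proof.
elim: s K => [|B s IHs] K.
  move=> _; rewrite big_nil mulr1 -prob_superset.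
  by congr (P _); apply/seteqP; split=> w /=; rewrite andbT.
rewrite pairwise_cons /= => /andP[/andP[KB Ks] /andP[Bs ds]].
have IHK : P [set w | (K \subset A w) && avoids s (A w)]
    = (p ^+ #|K| * \prod_(B <- s) (1 - p ^+ #|B|))%:E.
  by apply: IHs; rewrite pairwise_cons Ks.
have IHKB : P [set w | ((K :|: B)%SET \subset A w)
                       && avoids s (A w)]
    = (p ^+ (#|K| + #|B|) * \prod_(B <- s) (1 - p ^+ #|B|))%:E.
  rewrite -(_ : #|(K :|: B)%SET| = #|K| + #|B|)%N.
    apply: IHs; rewrite pairwise_cons ds andbT.
    apply/allP => C Cs; rewrite finset.disjoints_subset finset.subUset.
    rewrite -!finset.disjoints_subset.
    by rewrite (allP Ks _ Cs) (allP Bs _ Cs).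
  by apply/eqP; rewrite leq_card_setU.
pose E := [set w | (K \subset A w) && avoids s (A w)].
have -> : [set w | (K \subset A w) &&
                   (~~ (B \subset A w) && avoids s (A w))]
    = E `\` [set w | B \subset A w].
  apply/seteqP; split=> w /=; rewrite /E /=.
    by move=> /and3P[-> /negP ? ->].
  by move=> [/andP[-> ->] /negP ->].
rewrite measureD; last 3 first.
- exact: (measurable_random_set (fun S => (K \subset S)
            && avoids s S)).
- exact: (measurable_random_set (fun S => B \subset S)).
- by rewrite [X in (X < _)%E]IHK ltry.
have -> : E `&` [set w | B \subset A w] =
    [set w | ((K :|: B)%SET \subset A w) && avoids s (A w)].
  apply/seteqP; split=> w /=; rewrite /E /= finset.subUset.
    by move=> [/andP[-> ->] ->].
  by move=> /andP[/andP[-> ->] ->].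
rewrite [X in (X - _)%E]IHK [X in (_ - X)%E]IHKB.
by rewrite -EFinB big_cons exprD; congr EFin; ring.
Qed.

Lemma prob_avoid (D : {set {set 'I_N.+1}}) : finset.trivIset D ->
  P [set w | [forall B in D, ~~ (B \subset A w)]]
    = (\prod_(B in D) (1 - p ^+ #|B|))%:E.
Proof.
move=> tD.
have := prob_contain_avoid finset.set0 (enum D).
rewrite cards0 expr0 mul1r big_enum /= => <-.
  congr (P _); apply/seteqP; split=> w /=; rewrite finset.sub0set /=.
    by move=> /forall_inP DA; apply/allP => B; rewrite mem_enum => /DA.
  by move=> /allP DA; apply/forall_inP => B BD; apply: DA; rewrite mem_enum.
apply/andP; split.
  by apply/allP => B _; rewrite finset.disjoints_subset finset.sub0set.
have := enum_uniq (mem D); rewrite uniq_pairwise.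
apply: (sub_in_pairwise (P := mem D)).
  by move=> B C BD CD; apply: (finset.trivIsetP tD).
by apply/allP => B; rewrite mem_enum.
Qed.

Hypotheses (hp0 : 0 < p) (hp1 : p < 1).

Local Notation b := (Num.sqrt (1 - p ^+ 2)).

(** If [k] is not a sum, [A] contains none of the disjoint blocks [{i, k - i}];
    each of these contributes a factor at most [b ^ #|B|], and together they
    cover the [k + 1] integers of [0, ..., k]. *)
Lemma prob_missing_le (k : nat) : (k <= N)%N ->
  (P [set w | k \notin sumset (A w)] <= (b ^+ k.+1)%:E)%E.
Proof.
move=> kN.
pose refl (i : 'I_N.+1) : 'I_N.+1 := inord (k - i).
pose block (i : 'I_N.+1) : {set 'I_N.+1} := [set i; refl i]%SET.
(* The indices [i] and [k - i] give the same block, which counts once in [D]. *)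
pose D : {set {set 'I_N.+1}} :=
  [set block i | i in [pred i : 'I_N.+1 | (i <= k)%N]]%SET.
have reflE (i : 'I_N.+1) : refl i = (k - i)%N :> nat.
  by rewrite inordK //; lia.
have block_refl (i : 'I_N.+1) : (i <= k)%N -> block (refl i) = block i.
  move=> ik; rewrite /block finset.setUC; congr finset.setU; congr finset.set1.
  by apply: val_inj; rewrite /= !reflE; lia.
have block_eq (i x : 'I_N.+1) :
    (i <= k)%N -> x \in block i -> block i = block x.
  by move=> ik; rewrite !inE => /orP[] /eqP -> //; rewrite block_refl.
have tD : finset.trivIset D.
  apply/finset.trivIsetP => _ _ /imsetP[i ik ->] /imsetP[j jk ->].
  rewrite !inE in ik jk.
  apply: contraNT => /pred0Pn[x /andP[/= xi xj]].
  by rewrite (block_eq _ _ ik xi) (block_eq _ _ jk xj).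
have cover_ge : (k.+1 <= #|finset.cover D|)%N.
  have inj : injective (fun i : 'I_k.+1 => inord i : 'I_N.+1).
    have lt_N (i : 'I_k.+1) : (i < N.+1)%N by exact: leq_trans (ltn_ord i) _.
    by move=> i j /(congr1 val) /=; rewrite !inordK ?lt_N // => /ord_inj.
  rewrite -[X in (X <= _)%N]card_ord -(finset.card_imset _ inj).
  apply/subset_leq_card/fintype.subsetP => _ /imsetP[i _ ->].
  apply/finset.bigcupP; exists (block (inord i)); last by rewrite !inE eqxx.
  by have ik := ltn_ord i; apply: imset_f; rewrite inE inordK; lia.
have missing_avoids :
    [set w | k \notin sumset (A w)] `<=`
    [set w | [forall B in D, ~~ (B \subset A w)]].
  move=> w /= knA; apply/forall_inP => _ /imsetP[i ik ->].
  rewrite !inE in ik.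
  apply: contra knA => /fintype.subsetP iA.
  apply/existsP; exists i; rewrite iA ?inE ?eqxx //=.
  apply/existsP; exists (refl i); rewrite iA ?inE ?eqxx ?orbT //=.
  by rewrite reflE subnKC.
apply: (@le_trans _ _ (P [set w | [forall B in D, ~~ (B \subset A w)]])).
  apply: le_measure; rewrite ?inE //.
    exact: (measurable_random_set (fun S => k \notin sumset S)).
  exact: (measurable_random_set (fun S => [forall B in D, ~~ (B \subset S)])).
rewrite prob_avoid // lee_fin.
apply: (@le_trans _ _ (\prod_(B in D) b ^+ #|B|)).
  apply: ler_prod => B /imsetP[i _ ->].
  rewrite subr_ge0 exprn_ile1 ?(ltW hp0) ?(ltW hp1) //=.
  apply: block_factor_le => //.
  by rewrite /block finset.cards2; case: (_ != _).
rewrite prodrXr ler_wiXn2l ?ltW ?base_gt0 ?base_lt1 //.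
apply: leq_trans cover_ge _.
by rewrite (finset.leq_card_cover D).
Qed.

(** Union bound over the missing integers [n - 1 + i]; the geometric series
    starts at [b ^ n] because [k] is missing with probability at most
    [b ^ (k + 1)]. *)
Lemma prob_many_missing_le (n : nat) : (0 < n)%N ->
  (P [set w | (n <= missing_sums (A w))%N] <= (b ^+ n / (1 - b))%:E)%E.
Proof.
move=> n0; have b0 := base_gt0 _ _ hp0 hp1; have b1 := base_lt1 _ _ hp0.
set M := (N.+1 - n.-1)%N.
pose miss i := [set w | (n.-1 + i)%N \notin sumset (A w)].
have mmiss i : measurable (miss i).
  exact: (measurable_random_set (fun S => (n.-1 + i)%N \notin sumset S)).
apply: (@le_trans _ _ (\sum_(i < M) P (miss i))%E).
  apply: content_subadditive => //.
    exact: (measurable_random_set (fun S => (n <= missing_sums S)%N)).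
  move=> w /= /(missing_sums_large _ _ _ n0)[i iM iA].
  by rewrite -bigcup_mkord; exists i.
apply: (@le_trans _ _ (\sum_(i < M) (b ^+ n * b ^+ i)%:E)%E).
  apply: lee_sum => i _.
  rewrite -exprD -[X in b ^+ X](_ : (n.-1 + i).+1 = _); last lia.
  by apply: prob_missing_le; have := ltn_ord i; rewrite /M; lia.
rewrite sumEFin lee_fin -mulr_sumr ler_pM2l ?exprn_gt0 //.
rewrite -[leRHS]mul1r ler_pdivlMr ?subr_gt0 //.
have := subrX1 b M; have := exprn_ge0 M (ltW b0).
set s := (\sum_(i < M) b ^+ i)%R; lra.
Qed.

End RandomSet.

Theorem corollary3p1 (R : realType) (p : R) (hp0 : 0 < p) (hp1 : p < 1) :
  (exists C : R,
     forall (N n : nat), 1 / decay_rate p < n%:R ->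
     forall (d : measure_display) (T : measurableType d)
       (P : probability T R) (A : T -> {set 'I_N.+1}),
       bernoulli_random_set P p A ->
       (P [set w | (n <= missing_sums (A w))%N]
         <= (C * (n%:R * Num.sqrt (1 - p ^+ 2) ^+ n))%:E)%E)
  /\
  (forall eps : R, 0 < eps ->
     exists C : R,
       (forall n : nat, 1 / decay_rate p < n%:R ->
          n%:R * Num.sqrt (1 - p ^+ 2) ^+ n
            <= C * (Num.sqrt (1 - p ^+ 2) + eps) ^+ n)
       /\
       (forall (N n : nat), 1 / decay_rate p < n%:R ->
          forall (d : measure_display) (T : measurableType d)
            (P : probability T R) (A : T -> {set 'I_N.+1}),
            bernoulli_random_set P p A ->
            (P [set w | (n <= missing_sums (A w))%N]
              <= (C * (Num.sqrt (1 - p ^+ 2) + eps) ^+ n)%:E)%E)).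
Proof.
have b0 := base_gt0 _ _ hp0 hp1; have b1 := base_lt1 _ _ hp0.
set b := Num.sqrt (1 - p ^+ 2) in b0 b1 *.
have n_gt0 (n : nat) : 1 / decay_rate p < n%:R -> (0 < n)%N.
  rewrite -(ltr0n R); apply: lt_trans.
  by rewrite divr_gt0 // decay_rate_gt0.
have bC : 1 <= (1 - b)^-1 by rewrite invf_ge1 ?subr_gt0 // gerBl ltW.
have first_bound (N n : nat) : 1 / decay_rate p < n%:R ->
    forall (d : measure_display) (T : measurableType d)
      (P : probability T R) (A : T -> {set 'I_N.+1}),
    bernoulli_random_set P p A ->
    (P [set w | (n <= missing_sums (A w))%N]
      <= ((1 - b)^-1 * (n%:R * b ^+ n))%:E)%E.
  move=> /n_gt0 n0 d T P A bA.
  apply: le_trans (prob_many_missing_le _ _ _ _ _ _ _ bA hp0 hp1 _ n0) _.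
  rewrite lee_fin mulrC ler_pM2l ?invr_gt0 ?subr_gt0 //.
  by rewrite ler_peMl ?ler1n // exprn_ge0 // ltW.
split; first by exists (1 - b)^-1.
(* The first constant times the one of [natr_mul_expr_le]; as the former is at
   least 1, the product also serves for the purely analytic comparison. *)
move=> eps eps0; exists ((1 - b)^-1 * (b / eps)).
split=> [n _|N n nD d T P A bA].
  apply: (le_trans (natr_mul_expr_le _ _ _ _ b0 eps0)).
  rewrite -[leRHS]mulrA ler_peMl // mulr_ge0 ?exprn_ge0 //.
    by rewrite ltW // divr_gt0.
  by rewrite ltW // addr_gt0.
apply: le_trans (first_bound _ _ nD _ _ _ _ bA) _.
rewrite lee_fin -[leRHS]mulrA ler_pM2l ?invr_gt0 ?subr_gt0 //.
exact: natr_mul_expr_le.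
Qed.
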